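(* There is an absolute constant $C>0$ such that the following holds. For every function $R=R(m,\log\frac1\varepsilon)>0$ that is bounded by a polynomial in $m$ and $\log\frac1\varepsilon$, there exist $m\in\mathbb{N}$, $\varepsilon>0$, and a finite set $\mathcal{F}\subseteq\mathbb{Z}^m$ with $\|\alpha\|\le C m^{3/2}$ for every $\alpha\in\mathcal{F}$, and there exists $\theta\in\mathrm{conv}(\mathcal{F})$, such that for every $y\in B(0,R)$ we have $h_\theta(y)>g(\theta)+\varepsilon$.
   Context: For finite $\mathcal{F}\subseteq\mathbb{Z}^m$ and $\theta,y\in\mathbb{R}^m$, $h_\theta(y)=\log\big(\sum_{\alpha\in\mathcal{F}}e^{\langle\alpha-\theta,y\rangle}\big)$ (the dual of the max-entropy program with uniform prior) and $g(\theta)=\inf_{y\in\mathbb{R}^m}h_\theta(y)$. $\|\cdot\|$ is the Euclidean norm and $B(0,R)$ the closed Euclidean ball of radius $R$ around the origin. *)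

(* Defs.v *)
From HB Require Import structures.
From mathcomp Require Import all_boot all_order all_algebra finmap.
From mathcomp Require Import all_classical all_reals all_analysis.

Set Implicit Arguments.
Unset Strict Implicit.
Unset Printing Implicit Defensive.

Import Order.TTheory GRing.Theory Num.Theory.

Local Open Scope classical_set_scope.
Local Open Scope fset_scope.
Local Open Scope ring_scope.

Section MaxEntropyDual.
Context {R : realType} {m : nat}.
Implicit Types (x y theta : 'rV[R]_m) (F : {fset 'rV[int]_m}).

Definition dotp x y : R := \sum_(i < m) x 0 i * y 0 i.

(* The library norm `|x| on 'rV[R]_m is the sup norm, and ball / closed_ball
   refer to it; hence the Euclidean versions. *)
Definition l2norm x : R := Num.sqrt (dotp x x).

Definition l2closed_ball (r : R) : set 'rV[R]_m := [set y | l2norm y <= r].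

Definition toR (a : 'rV[int]_m) : 'rV[R]_m := map_mx intr a.

Definition conv_hull F : set 'rV[R]_m :=
  [set theta | exists2 w : 'rV[int]_m -> R,
     (forall a, a \in F -> 0 <= w a) /\ \sum_(a <- F) w a = 1 &
     theta = \sum_(a <- F) w a *: toR a].

Definition hdual F theta y : R :=
  ln (\sum_(a <- F) expR (dotp (toR a - theta) y)).

(* Extended-real infimum: for nonempty F it is -oo exactly when theta lies
   outside the convex hull of F, whereas the real-valued inf would be 0. *)
Definition gdual F theta : \bar R :=
  ereal_inf [set (hdual F theta y)%:E | y in [set: 'rV[R]_m]].

End MaxEntropyDual.

Arguments toR R {m} a.

(* p.[x, y] is evaluation of a bivariate real polynomial. *)
Definition poly_bounded {R : realType} (rad : nat -> R -> R) : Prop :=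
  exists p : {poly {poly R}}, forall (m : nat) (eps : R), 0 < eps ->
    rad m (ln eps^-1) <= p.[m%:R, ln eps^-1].

(* Main.v *)
(** At the vertex [theta = 0] of the hull of [0], [- e_0] and [2 e_(k-1) - e_k]
    (0 < k < m) one has [g = 0], approached by letting [y] go to infinity in a
    direction with negative product against every nonzero point.  But as soon as
    [h y <= ln (1 + 1/e)], each of these products is at most [-1], i.e.
    [y_0 >= 1] and [y_k >= 2 y_(k-1) + 1], so [y_(m-1) >= 2 ^ (m-1)].  Hence a
    constant [eps], namely [2 eps = ln (1 + 1/e)], already defeats every radius polynomial in [m]. *)
Require Import Defs.
From mathcomp Require Import all_boot all_order all_algebra finmap.
From mathcomp Require Import all_classical all_reals all_analysis.
From mathcomp Require Import ring lra.

Import Order.TTheory GRing.Theory Num.Theory.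
Local Open Scope classical_set_scope.
Local Open Scope fset_scope.
Local Open Scope ring_scope.

(** The Taylor term of degree [d + 1] in [2 ^ x = exp (x * ln 2)] outgrows [A * x ^ d], which bounds
    [q] once [x >= 1]. *)
Lemma poly_lt_exp2 {R : realType} (q : {poly R}) :
  exists n : nat, q.[n.+1%:R] < 2 ^+ n.
Proof.
pose d := size q; pose A : R := \sum_(i < d) `|q`_i|.
pose B : R := (ln 2) ^+ d.+1 / d.+1`!%:R.
have ln20 : 0 < ln (2 : R) by apply: ln_gt0; rewrite ltr1n.
have B0 : 0 < B by apply: divr_gt0; rewrite ?exprn_gt0 ?ltr0n ?fact_gt0.
have A0 : 0 <= A by rewrite sumr_ge0.
have : 0 <= 2 * A / B by apply: divr_ge0; [exact: mulr_ge0|exact: ltW].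
(* This [n] will give [2 * A < x * B]; the factor 2 pays for passing from [2 ^ (n + 1)] to
   [2 ^ n]. *)
move=> /archi_boundP; set n := Num.Def.archi_bound _ => nP.
exists n; set x : R := n.+1%:R.
have x1 : 1 <= x by rewrite ler1n.
have qA : q.[x] <= A * x ^+ d.
  rewrite horner_coef mulr_suml ler_sum// => i _.
  apply: (le_trans (ler_norm _)); rewrite normrM ler_wpM2l//.
  rewrite ger0_norm ?exprn_ge0 ?ler0n//.
  by rewrite ler_weXn2l// ltnW.
have xd0 : 0 < x ^+ d by rewrite exprn_gt0// (lt_le_trans ltr01).
have E : x ^+ d.+1 * B < 2 ^+ n.+1.
  rewrite -[X in _ < X ^+ _]lnK ?posrE ?ltr0n// -expRM_natl.
  have xln : 0 <= x * ln 2 by apply: mulr_ge0; exact: ltW.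
  by apply: lt_le_trans (expR_ge1Dxn d xln); rewrite exprMn -mulrA ltrDr.
have AB : 2 * A < x * B.
  rewrite -ltr_pdivrMr//; apply: (lt_le_trans nP).
  by rewrite ler_nat.
apply: (le_lt_trans qA); rewrite -(ltr_pM2l (ltr0Sn R 1)) -exprS.
apply: lt_trans E; rewrite mulrA exprS [ltRHS]mulrAC.
by rewrite ltr_pM2r.
Qed.

(** At [k = 0] the first indicator vanishes for every [j], so one formula covers both kinds of
    nonzero points. *)
Definition doubling_vec (n : nat) (k : 'I_n) : 'rV[int]_n :=
  \row_j ((j.+1 == k)%:R *+ 2 - (j == k)%:R).

Definition doubling_set (n : nat) : {fset 'rV[int]_n} :=
  0 |` [fset doubling_vec n k | k in 'I_n].

Lemma doubling_vec_neq0 (n : nat) (k : 'I_n) : doubling_vec n k != 0.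
Proof.
apply/eqP => /rowP /(_ k); rewrite !mxE eqxx.
by rewrite gtn_eqF.
Qed.

Lemma dotp0l {R : realType} (n : nat) (y : 'rV[R]_n) : dotp 0 y = 0.
Proof. by rewrite /dotp big1// => i _; rewrite mxE mul0r. Qed.

Lemma toR0 {R : realType} (n : nat) : toR R (0 : 'rV[int]_n) = 0.
Proof. exact: map_mx0. Qed.

Lemma toR_doubling_vec {R : realType} (n : nat) (k j : 'I_n) :
  toR R (doubling_vec n k) 0 j = (j.+1 == k)%:R *+ 2 - (j == k)%:R.
Proof. by rewrite !mxE rmorphB rmorphMn /= !rmorph_nat. Qed.

(** Indexing by a natural number through [inord] exposes the predecessor coordinate and prepares an
    induction on [k]. *)
Lemma dotp_doubling_vec {R : realType} (n k : nat) (y : 'rV[R]_n.+1) :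
  (k < n.+1)%N ->
  dotp (toR R (doubling_vec n.+1 (inord k))) y =
  (if k is k'.+1 then 2 * y 0 (inord k') else 0) - y 0 (inord k).
Proof.
move=> kn; rewrite /dotp; under eq_bigr do rewrite toR_doubling_vec mulrBl.
rewrite sumrB; congr (_ - _); last first.
  rewrite (bigD1 (inord k))//= eqxx mul1r big1 ?addr0// => i /negPf->.
  by rewrite mul0r.
rewrite inordK//; case: k kn => [|k] kn.
  by rewrite big1// => i _; rewrite mul0rn mul0r.
have kn' := ltnW kn.
rewrite (bigD1 (inord k))//= inordK// eqxx big1 ?addr0// => i.
rewrite eqSS -val_eqE/= inordK// => /negPf->.
by rewrite mul0rn mul0r.
Qed.

Lemma coord_le_l2norm {R : realType} (n : nat) (y : 'rV[R]_n) (i : 'I_n) :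
  y 0 i <= l2norm y.
Proof.
apply: (le_trans (ler_norm _)); rewrite -sqrtr_sqr ler_wsqrtr//.
rewrite /dotp (bigD1 i)//= -expr2 lerDl sumr_ge0// => j _.
by rewrite -expr2 sqr_ge0.
Qed.

Lemma l2norm_le_bounded {R : realType} (n : nat) (x : 'rV[R]_n) (c : R) :
  (forall i, `|x 0 i| <= c) -> l2norm x <= `|c| * n%:R `^ (3 / 2).
Proof.
(* Raising the exponent of the dimension from 1/2 to 3/2 enlarges the bound only when the base is at
   least 1, so dimension 0 is separate. *)
case: n x => [|n] x xc.
  by rewrite /l2norm /dotp big_ord0 sqrtr0 mulr_ge0 ?powR_ge0.
have n1 : 1 <= n.+1%:R :> R by rewrite ler1n.
apply: (@le_trans _ _ (`|c| * Num.sqrt n.+1%:R)); last first.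
  rewrite ler_wpM2l// -powR12_sqrt ?ler0n//.
  by apply: ler_powR => //; lra.
rewrite -sqrtr_sqr -sqrtrM ?sqr_ge0// ler_wsqrtr//.
rewrite /dotp mulr_natr -[X in _ *+ X]card_ord -sumr_const ler_sum// => i _.
rewrite -expr2 -real_normK ?num_real// ler_sqr ?nnegrE//.
exact: (le_trans (normr_ge0 _) (xc i)).
Qed.

Lemma l2norm_doubling_set {R : realType} (n : nat) (a : 'rV[int]_n) :
  a \in doubling_set n -> l2norm (toR R a) <= 2 * n%:R `^ (3 / 2).
Proof.
move=> aF; have := @l2norm_le_bounded R n (toR R a) 2.
rewrite (ger0_norm (ler0n _ 2)); apply => i.
move: aF => /fset1UP[->|/imfsetP[k _ ->]].
  by rewrite toR0 mxE normr0.
rewrite toR_doubling_vec.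
(* The two indicators never hold together, but even that case would give 1, within the bound 2. *)
case: (_ == _); case: (_ == _); rewrite /= ler_norml; lra.
Qed.

Lemma conv_hull_mem {R : realType} (n : nat) (F : {fset 'rV[int]_n}) a :
  a \in F -> conv_hull F (toR R a).
Proof.
move=> aF; exists (fun b => (b == a)%:R); first split.
- by move=> b _; case: (_ == _).
- rewrite (big_fsetD1 a)//= eqxx big_seq big1 ?addr0// => b.
  by rewrite !inE => /andP[/negPf->].
- rewrite (big_fsetD1 a)//= eqxx scale1r big_seq big1 ?addr0// => b.
  by rewrite !inE => /andP[/negPf->]; rewrite scale0r.
Qed.

(** The point 0 contributes exactly 1, so the sum over the other points measures how far [hdual]
    lies above 0. *)
Lemma hdual_doubling_set {R : realType} (n : nat) (y : 'rV[R]_n) :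
  hdual (doubling_set n) 0 y =
  ln (1 + \sum_(a <- doubling_set n `\ 0) expR (dotp (toR R a) y)).
Proof.
rewrite /hdual (big_fsetD1 0) ?fset1U1//= subr0 toR0 dotp0l expR0.
by under eq_bigr do rewrite subr0.
Qed.

Lemma hdual_doubling_set_small {R : realType} (n : nat) (eps : R) :
  0 < eps -> exists y, hdual (doubling_set n.+1) 0 y <= eps.
Proof.
move=> eps0; pose t : R := n.+1%:R / eps.
(* Solution of [y_0 = t], [y_k = 2 y_(k-1) + t], which makes every product equal to [- t]. *)
pose y : 'rV[R]_n.+1 := \row_j (t * (2 ^+ j.+1 - 1)).
have dy k : dotp (toR R (doubling_vec n.+1 k)) y = - t.
  rewrite -(inord_val k) dotp_doubling_vec//.
  case: k => -[|k] kn /=; rewrite !mxE ?inordK ?(ltnW kn)//; rewrite ?exprS; ring.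
have t0 : 0 < t by rewrite divr_gt0 ?ltr0n.
exists y; rewrite hdual_doubling_set.
apply: (@le_trans _ _ (ln (1 + eps))); last exact: le_ln1Dx (lt_trans _ eps0).
have S0 : 0 <= \sum_(a <- doubling_set n.+1 `\ 0) expR (dotp (toR R a) y).
  by rewrite sumr_ge0// => a _; rewrite expR_ge0.
rewrite ler_ln ?posrE ?ltr_wpDr//; last exact: ltW.
rewrite lerD2l big_seq.
apply: (@le_trans _ _
  (\sum_(a <- doubling_set n.+1 `\ 0 | a \in doubling_set n.+1 `\ 0)
     expR (- t))).
  apply: ler_sum => a; rewrite !inE => /andP[/negPf-> /= /imfsetP[k _ ->]].
  by rewrite dy.
rewrite -big_seq big_const_seq count_predT iter_addr_0.
have cardF : (size (doubling_set n.+1 `\ 0%R) <= n.+1)%N.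
  apply: (@leq_trans #|` [fset doubling_vec n.+1 k | k in 'I_n.+1]|).
    by apply: fsubset_leq_card; apply/fsubsetP => a; rewrite !inE => /andP[/negPf->].
  by apply: (leq_trans (leq_imfset_card _ _ _)); rewrite -cardE card_ord.
apply: (@le_trans _ _ (n.+1%:R * expR (- t))).
  by rewrite mulr_natl ler_wpMn2l// expR_ge0.
(* The choice of [t] pays off here: [exp t >= 1 + t >= t = (n + 1) / eps]. *)
rewrite expRN ler_pdivrMr ?expR_gt0// -ler_pdivrMl// mulrC -/t.
by apply: (le_trans _ (expR_ge1Dx t)); rewrite lerDr.
Qed.

Lemma hdual_doubling_set_coord {R : realType} (n k : nat) (y : 'rV[R]_n.+1) :
  hdual (doubling_set n.+1) 0 y <= ln (1 + expR (-1)) -> (k < n.+1)%N ->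
  2 ^+ k <= y 0 (inord k).
Proof.
rewrite hdual_doubling_set.
have S0 (F : {fset 'rV[int]_n.+1}) : 0 <= \sum_(a <- F) expR (dotp (toR R a) y).
  by rewrite sumr_ge0// => a _; rewrite expR_ge0.
rewrite ler_ln ?posrE ?ltr_wpDr ?expR_ge0// lerD2l => hy.
(* The exponentials are nonnegative with sum at most [exp (-1)], so each one obeys this bound
   alone. *)
have dy (j : 'I_n.+1) : dotp (toR R (doubling_vec n.+1 j)) y <= -1.
  rewrite -ler_expR (le_trans _ hy)// (big_fsetD1 (doubling_vec n.+1 j))/= ?lerDl//.
  by rewrite !inE doubling_vec_neq0/=; apply/orP; right; apply/imfsetP; exists j.
(* The base is [y_0 >= 1]; in the step, the surplus 1 in [y_(k+1) >= 2 y_k + 1] is dropped. *)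
elim: k => [|k IH] kn; have := dy (inord _); first move=> /(_ 0%N).
  by rewrite dotp_doubling_vec//; lra.
move=> /(_ k.+1); rewrite dotp_doubling_vec// exprS.
have := IH (ltnW kn); lra.
Qed.

Theorem theorem2p3 (R : realType) :
  exists2 C : R, 0 < C &
    forall rad : nat -> R -> R,
      (forall (m : nat) (eps : R), 0 < eps -> 0 < rad m (ln eps^-1)) ->
      poly_bounded rad ->
      exists (m : nat) (eps : R) (F : {fset 'rV[int]_m}) (theta : 'rV[R]_m),
        [/\ 0 < eps,
            forall a, a \in F -> l2norm (toR R a) <= C * m%:R `^ (3 / 2),
            conv_hull F theta &
            forall y : 'rV[R]_m, l2closed_ball (rad m (ln eps^-1)) y ->
              (gdual F theta + eps%:E < (hdual F theta y)%:E)%E].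
Proof.
exists 2 => // rad _ [p radp].
(* Half of the threshold serves as the upper bound on [gdual], the other half as the required
   gap. *)
pose eps : R := ln (1 + expR (-1)) / 2.
have eps0 : 0 < eps by rewrite divr_gt0 ?ln_gt0// ltrDl expR_gt0.
(* With [eps] fixed, swapping the variables allows the logarithm to be substituted first, leaving a
   univariate polynomial in the dimension. *)
have [n] := poly_lt_exp2 (swapXY p).[(ln eps^-1)%:P].
rewrite horner2_swapXY => pn.
exists n.+1, eps, (doubling_set n.+1), 0; split => //.
- exact: l2norm_doubling_set.
- by rewrite -toR0; apply: conv_hull_mem; rewrite fset1U1.
move=> y yr; have [z hz] := hdual_doubling_set_small n eps eps0.
have gz : (gdual (doubling_set n.+1) 0 <= eps%:E)%E.
  apply: (@le_trans _ _ (hdual (doubling_set n.+1) 0 z)%:E); last by rewrite lee_fin.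
  by apply: ereal_inf_lbound; exists z.
apply: (le_lt_trans (leeD2r _ gz)); rewrite -EFinD lte_fin ltNge.
have -> : eps + eps = ln (1 + expR (-1)) by rewrite /eps; field.
(* The last coordinate yields the contradiction [2 ^ n <= y_n <= l2norm y <= rad <= p < 2 ^ n]. *)
apply/negP => /(@hdual_doubling_set_coord R n n)/(_ (ltnSn n)) yn.
have := le_trans yn (le_trans (coord_le_l2norm _ _ _) yr).
by move=> /le_trans/(_ (radp _ _ eps0))/le_lt_trans/(_ pn); rewrite ltxx.
Qed.
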